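(* The maximum of $\operatorname{sos}(P)$ over all $3\times 3$ simple biquadratic forms $P$ is equal to $6$.
   Context: An $m\times n$ biquadratic form is a real polynomial $P(\mathbf{x},\mathbf{y})=\sum_{i,k=1}^{m}\sum_{j,l=1}^{n} a_{ijkl}x_ix_ky_jy_l$ in variables $\mathbf{x}=(x_1,\dots,x_m)$, $\mathbf{y}=(y_1,\dots,y_n)$. It is called simple if it is a sum of distinct terms of the type $x_i^2y_j^2$ (each with coefficient $1$), i.e. $P=\sum_{(i,j)\in E}x_i^2y_j^2$ for some nonempty set $E\subseteq\{1,\dots,m\}\times\{1,\dots,n\}$. A bilinear form is a polynomial $\sum_{i,j} c_{ij}x_iy_j$ with real coefficients. $P$ is SOS if it is a finite sum of squares of bilinear forms; its SOS rank $\operatorname{sos}(P)$ is the smallest number of squares of bilinear forms in such a representation. *)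

(* Defs.v *)
From HB Require Import structures.
From mathcomp Require Import all_boot all_order all_algebra.
From mathcomp Require Import mpoly.
From mathcomp Require Import reals.

Set Implicit Arguments.
Unset Strict Implicit.
Unset Printing Implicit Defensive.

Import GRing.Theory.
Local Open Scope ring_scope.

Section Biquadratic.
Variables (R : realType) (m n : nat).

(* The m + n indeterminates are split as x_1, ..., x_m, y_1, ..., y_n. *)
Definition xvar (i : 'I_m) : {mpoly R[m + n]} := 'X_(lshift n i).
Definition yvar (j : 'I_n) : {mpoly R[m + n]} := 'X_(rshift m j).

Definition biquadratic_form (P : {mpoly R[m + n]}) : Prop :=
  exists a : 'I_m -> 'I_n -> 'I_m -> 'I_n -> R,
    P = \sum_(i < m) \sum_(k < m) \sum_(j < n) \sum_(l < n)
          a i j k l *: (xvar i * xvar k * yvar j * yvar l).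

Definition simple_biquadratic_form (P : {mpoly R[m + n]}) : Prop :=
  biquadratic_form P /\
  exists2 E : {set 'I_m * 'I_n}, E != set0 &
    P = \sum_(e in E) xvar e.1 ^+ 2 * yvar e.2 ^+ 2.

Definition bilinear_form (B : {mpoly R[m + n]}) : Prop :=
  exists c : 'M[R]_(m, n),
    B = \sum_(i < m) \sum_(j < n) c i j *: (xvar i * yvar j).

Definition sum_of_squares (P : {mpoly R[m + n]}) (r : nat) : Prop :=
  exists2 B : 'I_r -> {mpoly R[m + n]},
    forall k, bilinear_form (B k) & P = \sum_(k < r) B k ^+ 2.

(* sos(P) = r, as a relation: it holds for no r when P is not SOS. *)
Definition sos_rank (P : {mpoly R[m + n]}) (r : nat) : Prop :=
  sum_of_squares P r /\ forall s : nat, sum_of_squares P s -> (r <= s)%N.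

End Biquadratic.

(* Main.v *)
Require Import Defs.
From HB Require Import structures.
From mathcomp Require Import all_boot all_order all_algebra.
From mathcomp Require Import mpoly.
From mathcomp Require Import reals.
From mathcomp Require boolp.
From mathcomp Require Import ring lra zify.

(** A simple form is the edge sum of a bipartite graph [E], each edge
    [(i, j)] contributing [x_i^2 y_j^2], so [#|E|] squares always suffice.

    Upper bound.  A 4-cycle costs only two squares instead of four, by
    Brahmagupta's identity
      [(a^2 + b^2)(c^2 + d^2) = (ac + bd)^2 + (ad - bc)^2].
    A graph on 3 + 3 vertices with 7 or 8 edges contains a 4-cycle: the at most
    two missing edges are killed by deleting one row and one column, and the
    2 x 2 rectangle that remains lies in [E].  Hence at most 2 + (8 - 4) = 6
    squares.  For the complete graph, Lagrange's identity
      [|x|^2 |y|^2 = (x . y)^2 + |x ^ y|^2]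
    gives four squares.

    Lower bound.  Write a representation with [s] squares as
    [P(x, y) = |sum_(i, j) x_i y_j v_ij|^2] with [v_ij] in [R^s].  Comparing
    values gives [|v_ij|^2 = 1] on [E] and [v_ij = 0] off [E], [v_ij] and
    [v_il] are orthogonal, as are [v_ij] and [v_kj], and
    [v_ij . v_kl + v_il . v_kj = 0].  If [E] has no 4-cycle, one of [v_il],
    [v_kj] vanishes whenever [(i, j)] and [(k, l)] are disjoint edges, so the
    [v_e] with [e] in [E] are orthonormal and [#|E| <= s]
    ([c4free_sos_lower_bound]).  The 6-cycle, that is the off-diagonal edges of
    [K_(3,3)], has no 4-cycle, so it needs all six squares. *)

Set Implicit Arguments.
Unset Strict Implicit.
Unset Printing Implicit Defensive.

Import GRing.Theory Num.Theory.
Local Open Scope ring_scope.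

(** * The inner product of row vectors *)

Section Dot.
Variables (R : realType) (s : nat).
Implicit Types u v w : 'rV[R]_s.

Definition dot u v : R := (u *m v^T) 0 0.

Lemma dotC u v : dot u v = dot v u.
Proof. by rewrite /dot -[u *m _]trmxK trmx_mul trmxK mxE. Qed.

Lemma dotDl u v w : dot (u + v) w = dot u w + dot v w.
Proof. by rewrite /dot mulmxDl mxE. Qed.

Lemma dotDr u v w : dot u (v + w) = dot u v + dot u w.
Proof. by rewrite dotC dotDl ![dot _ u]dotC. Qed.

Lemma dot0l u : dot 0 u = 0.
Proof. by rewrite /dot mul0mx mxE. Qed.

Lemma dot_eq0 u : dot u u = 0 -> u = 0.
Proof.
rewrite /dot mxE => /eqP; rewrite psumr_eq0 => [/allP u0|k _]; last first.
  by rewrite mxE -expr2 sqr_ge0.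
apply/rowP => k; have := u0 k (mem_index_enum k).
by rewrite /= !mxE -expr2 sqrf_eq0 => /eqP.
Qed.

End Dot.

(** * Simple forms as edge sums of bipartite graphs *)

Section Forms.
Variables (R : realType) (m n : nat).
Implicit Types (P Q : {mpoly R[m + n]}) (E F : {set 'I_m * 'I_n}).

Local Notation x i := (@xvar R m n i).
Local Notation y j := (@yvar R m n j).

Definition simple_form E : {mpoly R[m + n]} :=
  \sum_(e in E) x e.1 ^+ 2 * y e.2 ^+ 2.

Lemma simple_form_pairE E : simple_form E =
  \sum_i \sum_j if (i, j) \in E then x i ^+ 2 * y j ^+ 2 else 0.
Proof.
by rewrite pair_bigA /simple_form big_mkcond; apply: eq_bigr => -[i j].
Qed.

Lemma simple_form_simple E :
  E != set0 -> simple_biquadratic_form (simple_form E).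
Proof.
move=> En0; split; last by exists E.
exists (fun i j k l => ((i == k) && (j == l) && ((i, j) \in E))%:R).
rewrite simple_form_pairE; apply: eq_bigr => i _; rewrite (bigD1 i) //= [X in _ = _ + X]big1 ?addr0.
  apply: eq_bigr => j _; rewrite (bigD1 j) //= [X in _ = _ + X]big1 ?addr0.
    by rewrite !eqxx /=; case: ifP => _; rewrite ?scale1r ?scale0r // !expr2 !mulrA.
  by move=> l lj; rewrite [j == l]eq_sym (negPf lj) andbF scale0r.
move=> k ki; apply: big1 => j _; apply: big1 => l _.
by rewrite [i == k]eq_sym (negPf ki) scale0r.
Qed.

Lemma bilinear_monomial i j : bilinear_form (x i * y j).
Proof.
exists (delta_mx i j); rewrite (bigD1 i) //= [X in _ = _ + X]big1 ?addr0.
  rewrite (bigD1 j) //= [X in _ = _ + X]big1 ?addr0 ?mxE ?eqxx ?scale1r //.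
  by move=> l lj; rewrite mxE (negPf lj) andbF scale0r.
by move=> k ki; apply: big1 => l _; rewrite mxE (negPf ki) scale0r.
Qed.

Lemma bilinearD P Q :
  bilinear_form P -> bilinear_form Q -> bilinear_form (P + Q).
Proof.
move=> [c ->] [d ->]; exists (c + d); rewrite -big_split; apply: eq_bigr => i _.
by rewrite -big_split; apply: eq_bigr => j _; rewrite mxE scalerDl.
Qed.

Lemma bilinearB P Q :
  bilinear_form P -> bilinear_form Q -> bilinear_form (P - Q).
Proof.
move=> [c ->] [d ->]; exists (c - d); rewrite -sumrB; apply: eq_bigr => i _.
by rewrite -sumrB; apply: eq_bigr => j _; rewrite !mxE scalerBl.
Qed.

Lemma sos_sqr P : bilinear_form P -> sum_of_squares (P ^+ 2) 1.
Proof. by move=> bP; exists (fun=> P) => //; rewrite big_ord1. Qed.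

Lemma sosD P Q r s :
  sum_of_squares P r -> sum_of_squares Q s -> sum_of_squares (P + Q) (r + s).
Proof.
move=> [B bB ->] [C bC ->].
exists (fun k => match split k with inl i => B i | inr j => C j end).
  by move=> k; case: split.
rewrite big_split_ord; congr (_ + _); apply: eq_bigr => k _.
  by rewrite -[lshift s k]/(unsplit (inl k)) unsplitK.
by rewrite -[rshift r k]/(unsplit (inr k)) unsplitK.
Qed.

Lemma simple_form_setID E F :
  F \subset E -> simple_form E = simple_form F + simple_form (E :\: F).
Proof. by move=> /setIidPr sFE; rewrite /simple_form (big_setID F) sFE. Qed.

Lemma sos_simple_form E : sum_of_squares (simple_form E) #|E|.
Proof.
exists (fun k => let e := enum_val k in x e.1 * y e.2).
  by move=> k; apply: bilinear_monomial.
rewrite /simple_form big_enum_val /=.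
by apply: eq_bigr => k _; rewrite exprMn.
Qed.

(** Brahmagupta's identity: four edges for the price of two squares. *)
Lemma sos_four_cycle a b c d :
  a != b -> c != d ->
  sum_of_squares (simple_form (setX [set a; b] [set c; d])) 2.
Proof.
move=> ab cd.
have -> : simple_form (setX [set a; b] [set c; d]) =
    (x a * y c + x b * y d) ^+ 2 + (x a * y d - x b * y c) ^+ 2.
  rewrite /simple_form.
  rewrite (eq_bigl (fun e => (e.1 \in [set a; b]) && (e.2 \in [set c; d])));
    last by move=> e; rewrite inE.
  rewrite -(pair_big _ _ (fun i j => x i ^+ 2 * y j ^+ 2)) /=.
  rewrite big_setU1 ?inE //= big_set1 !big_setU1 ?inE //= !big_set1; ring.
by apply: (@sosD _ _ 1 1); apply: sos_sqr; [apply: bilinearD|apply: bilinearB];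
   apply: bilinear_monomial.
Qed.

Lemma sos_rank_le P r :
  sum_of_squares P r -> exists2 s, sos_rank P s & (s <= r)%N.
Proof.
move=> Pr; have exP : exists s, boolp.asbool (sum_of_squares P s).
  by exists r; apply/boolp.asboolP.
case: (ex_minnP exP) => s /boolp.asboolP Ps min_s.
by exists s; [split=> // t Pt|]; apply: min_s; apply/boolp.asboolP.
Qed.

(** * Forms of graphs without 4-cycles *)

Definition c4free E := forall i k j l, i != k -> j != l ->
  (i, j) \in E -> (k, l) \in E -> (i, l) \in E -> (k, j) \notin E.

Definition point (u : 'I_m -> R) (v : 'I_n -> R) (k : 'I_(m + n)) : R :=
  match split k with inl i => u i | inr j => v j end.

Lemma meval_xvar u v i : (x i).@[point u v] = u i.
Proof. by rewrite mevalXU /point -[lshift n i]/(unsplit (inl i)) unsplitK. Qed.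

Lemma meval_yvar u v j : (y j).@[point u v] = v j.
Proof. by rewrite mevalXU /point -[rshift m j]/(unsplit (inr j)) unsplitK. Qed.

Lemma meval_simple_form E u v : (simple_form E).@[point u v] =
  \sum_i \sum_j ((i, j) \in E)%:R * (u i ^+ 2 * v j ^+ 2).
Proof.
rewrite simple_form_pairE rmorph_sum; apply: eq_bigr => i _.
rewrite rmorph_sum; apply: eq_bigr => j _ /=.
case: ifP => _; rewrite ?mul0r ?rmorph0 // mul1r rmorphM !rmorphXn /=.
by rewrite meval_xvar meval_yvar.
Qed.

(** The vectors [v i j] have the coefficients of [x_i y_j] in the successive
    bilinear forms as coordinates.  Evaluating at the indicators of [A] and [B] sums
    them over the rectangle [A x B]; small rectangles then give, by
    polarization, all the inner products that the form determines. *)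
Lemma sos_rectangle E s : sum_of_squares (simple_form E) s ->
  exists v : 'I_m -> 'I_n -> 'rV[R]_s, forall (A : {set 'I_m}) (B : {set 'I_n}),
    let w := \sum_(i in A) \sum_(j in B) v i j in
    dot w w = \sum_(i in A) \sum_(j in B) ((i, j) \in E)%:R.
Proof.
move=> [S bS ES].
have [c cS] := boolp.choice bS.
exists (fun i j => \row_k c k i j) => A B w.
pose u i : R := (i \in A)%:R; pose v j : R := (j \in B)%:R.
transitivity ((simple_form E).@[point u v]).
  rewrite ES rmorph_sum /dot mxE; apply: eq_bigr => k _; rewrite mxE -expr2.
  rewrite rmorphXn cS /= rmorph_sum; congr (_ ^+ 2).
  rewrite summxE big_mkcond; apply: eq_bigr => i _ /=.
  rewrite rmorph_sum /= /u; case: ifP => iA; last first.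
    by rewrite big1 // => j _; rewrite mevalZ rmorphM /= meval_xvar iA mul0r mulr0.
  rewrite summxE big_mkcond; apply: eq_bigr => j _ /=.
  rewrite mevalZ rmorphM /= meval_xvar meval_yvar iA mxE mul1r /v.
  by case: (j \in B); rewrite ?mulr1 ?mulr0.
rewrite meval_simple_form [RHS]big_mkcond; apply: eq_bigr => i _; rewrite /u.
case: ifP => iA; last by rewrite big1 // => j _; rewrite expr0n mul0r mulr0.
rewrite [RHS]big_mkcond; apply: eq_bigr => j _; rewrite /v.
by case: ifP => jB; rewrite expr1n mul1r ?expr1n ?expr0n ?mulr1 ?mulr0.
Qed.

Lemma sos_gram E s : sum_of_squares (simple_form E) s ->
  exists v : 'I_m -> 'I_n -> 'rV[R]_s,
  [/\ forall i j, dot (v i j) (v i j) = ((i, j) \in E)%:R,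
      forall i j l, j != l -> dot (v i j) (v i l) = 0,
      forall i k j, i != k -> dot (v i j) (v k j) = 0 &
      forall i k j l, i != k -> j != l ->
        dot (v i j) (v k l) + dot (v i l) (v k j) = 0].
Proof.
move=> /sos_rectangle[v rect]; exists v.
have nrm i j : dot (v i j) (v i j) = ((i, j) \in E)%:R.
  by have := rect [set i] [set j]; rewrite !big_set1.
have row i j l : j != l -> dot (v i j) (v i l) = 0.
  move=> jl; have := rect [set i] [set j; l].
  rewrite !big_set1 !big_setU1 ?inE //= !big_set1 !(dotDl, dotDr) !nrm.
  by rewrite [dot (v i l) _]dotC; lra.
have col i k j : i != k -> dot (v i j) (v k j) = 0.
  move=> ik; have := rect [set i; k] [set j].
  rewrite !big_setU1 ?inE //= !big_set1 !(dotDl, dotDr) !nrm.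
  by rewrite [dot (v k j) _]dotC; lra.
split=> // i k j l ik jl; have := rect [set i; k] [set j; l].
rewrite !big_setU1 ?inE //= !big_set1 !big_setU1 ?inE //= !big_set1.
have lj : l != j by rewrite eq_sym.
have ki : k != i by rewrite eq_sym.
rewrite !(dotDl, dotDr) !nrm !row // !col //.
by rewrite [dot (v k j) (v i l)]dotC [dot (v k l) (v i j)]dotC; lra.
Qed.

(** Without a 4-cycle the anti-diagonal term of each 2 x 2 relation vanishes,
    so the edge vectors are orthonormal, hence independent in [R^s]. *)
Lemma c4free_sos_lower_bound E s :
  c4free E -> sum_of_squares (simple_form E) s -> (#|E| <= s)%N.
Proof.
move=> freeE /sos_gram[v [nrm row col diag]].
have v0 i j : (i, j) \notin E -> v i j = 0.
  by move=> /negPf ijE; apply: dot_eq0; rewrite nrm ijE.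
have orth e f : e \in E -> f \in E -> e != f -> dot (v e.1 e.2) (v f.1 f.2) = 0.
  case: e f => [i j] [k l] /= ijE klE.
  have [<-|ik] := eqVneq i k; have [<-|jl] := eqVneq j l => e_f.
  - by rewrite eqxx in e_f.
  - exact: row.
  - exact: col.
  have := diag _ _ _ _ ik jl.
  have [ilE|ilE] := boolP ((i, l) \in E); last by rewrite (v0 i l) // dot0l addr0.
  have kjE := freeE _ _ _ _ ik jl ijE klE ilE.
  by rewrite (v0 k j) // [dot _ 0]dotC dot0l addr0.
pose V : 'M[R]_(#|E|, s) :=
  \matrix_(p, k) v (enum_val p).1 (enum_val p).2 0 k.
suff : row_free V by rewrite /row_free => /eqP <-; apply: rank_leq_col.
apply/row_freeP; exists V^T; apply/matrixP => p q.
transitivity (dot (v (enum_val p).1 (enum_val p).2)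
                  (v (enum_val q).1 (enum_val q).2)).
  by rewrite /dot !mxE; apply: eq_bigr => k _; rewrite !mxE.
rewrite mxE; have [<-|pq] := eqVneq p q.
  by rewrite nrm -surjective_pairing enum_valP.
by rewrite orth ?enum_valP // (inj_eq enum_val_inj).
Qed.

End Forms.

(** * The 3 x 3 case *)

Section ThreeByThree.
Variable R : realType.
Implicit Type E : {set 'I_3 * 'I_3}.

Local Notation x i := (@xvar R 3 3 i).
Local Notation y j := (@yvar R 3 3 j).

(** Lagrange's identity, the two factors being [|x|^2] and [|y|^2]. *)
Lemma sos_complete33 : sum_of_squares (@simple_form R 3 3 setT) 4.
Proof.
pose a := ord0 : 'I_3; pose b := lift ord0 (ord0 : 'I_2) : 'I_3.
pose c := lift ord0 (lift ord0 (ord0 : 'I_1)) : 'I_3.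
pose minor i j := x i * y j - x j * y i.
have bil_minor i j : bilinear_form (minor i j).
  by apply: bilinearB; apply: bilinear_monomial.
have -> : simple_form R setT = (x a * y a + x b * y b + x c * y c) ^+ 2 +
    (minor a b ^+ 2 + (minor a c ^+ 2 + minor b c ^+ 2)).
  by rewrite simple_form_pairE !big_ord_recl !big_ord0 !inE /minor -/a -/b -/c; ring.
do 3?[apply: (@sosD _ _ _ _ _ 1)]; apply: sos_sqr => //.
by do 2?[apply: bilinearD]; apply: bilinear_monomial.
Qed.

Lemma setC1_ord3 (i : 'I_3) : exists a b, a != b /\ [set~ i] = [set a; b].
Proof.
have /cards2P[a [b [ab ->]]] : #|[set~ i]| == 2%N by rewrite cardsC1 card_ord.
by exists a, b.
Qed.

Lemma sos_simple33_le6 E :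
  exists2 r, sum_of_squares (@simple_form R 3 3 E) r & (r <= 6)%N.
Proof.
have cardEC := cardsC E; rewrite card_prod card_ord in cardEC.
have [E6|E7] := leqP #|E| 6; first by exists #|E| => //; apply: sos_simple_form.
have [E0|/set0Pn[p pE]] := eqVneq (~: E) set0.
  by exists 4 => //; rewrite -[E]setCK E0 setC0; apply: sos_complete33.
(* At most one edge besides [p] is missing; [q = p] if there is none.
   Deleting the row of [p] and the column of [q] then removes every gap. *)
have [q sub_pq] : exists q, ~: E \subset [set p; q].
  have := cardsD1 p (~: E); rewrite pE => card_pE.
  have : (#|~: E :\ p| <= 1)%N by lia.
  rewrite leq_eqVlt ltnS leqn0 cards_eq0 => /orP[/cards1P[q Eq]|/eqP E0].
    by exists q; rewrite -(setD1K pE) Eq.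
  by exists p; rewrite -(setD1K pE) E0 setU0 setUid.
pose F : {set 'I_3 * 'I_3} := setX [set~ p.1] [set~ q.2].
have sFE : F \subset E.
  apply/subsetP => -[i j]; rewrite !inE /= => /andP[ip jq].
  apply: contraT => ijE; have := subsetP sub_pq (i, j).
  rewrite !inE ijE => /(_ isT)/orP[] /eqP eij.
    by rewrite -eij eqxx in ip.
  by rewrite -eij eqxx in jq.
have cardF : #|F| = 4%N by rewrite cardsX !cardsC1 card_ord.
exists (2 + #|E :\: F|)%N; last first.
  have := cardsID F E; rewrite (setIidPr sFE) cardF.
  have : (0 < #|~: E|)%N by apply/card_gt0P; exists p.
  lia.
rewrite (simple_form_setID R sFE); apply: sosD; last exact: sos_simple_form.
rewrite /F; have [a [b [ab ->]]] := setC1_ord3 p.1.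
by have [c [d [cd ->]]] := setC1_ord3 q.2; apply: sos_four_cycle.
Qed.

Definition hexagon : {set 'I_3 * 'I_3} := [set e | e.1 != e.2].

Lemma card_hexagon : #|hexagon| = 6%N.
Proof.
rewrite -sum1_card (eq_bigl (fun e => e.1 != e.2)) => [|e]; last by rewrite inE.
by rewrite big_mkcond -(pair_bigA _ (fun i j => if i != j then 1 else 0)%N)
           !big_ord_recl !big_ord0.
Qed.

(** A 4-cycle on rows [i], [k] needs two columns outside [{i, k}]. *)
Lemma c4free_hexagon : c4free hexagon.
Proof.
move=> i k j l ik jl; rewrite !inE /= => ij kl il; rewrite negbK.
move: ik jl ij kl il; rewrite -!val_eqE /=.
by move: (ltn_ord i) (ltn_ord j) (ltn_ord k) (ltn_ord l); lia.
Qed.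

End ThreeByThree.

Theorem theorem2p5 (R : realType) :
  (forall P : {mpoly R[3 + 3]}, simple_biquadratic_form P ->
     exists2 r : nat, sos_rank P r & (r <= 6)%N) /\
  (exists2 P : {mpoly R[3 + 3]}, simple_biquadratic_form P & sos_rank P 6).
Proof.
split=> [P [_ [E _ ->]]|].
  have [r sosE r6] := sos_simple33_le6 R E.
  by have [s sos_s sr] := sos_rank_le sosE; exists s => //; apply: leq_trans r6.
exists (simple_form R hexagon).
  by apply: simple_form_simple; rewrite -card_gt0 card_hexagon.
rewrite -card_hexagon; split; first exact: sos_simple_form.
by move=> s; apply: c4free_sos_lower_bound c4free_hexagon.
Qed.
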